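(* Let $d\in\mathbb N$ and let $\odot$ be a universal product in the category $\mathrm{AlgP}_d$ satisfying (U1), (U2) and (U6) (see context). Let $(\mathcal A,\varphi^1,\dots,\varphi^d)$ be an object of $\mathrm{AlgP}_d$ and $(\mathcal A_i)_{i\in I}$ a family of subalgebras of $\mathcal A$ with $I\subseteq\mathbb N$. Then $(\mathcal A_i)_{i\in I}$ is $\odot$-independent if and only if it is $\mathcal S_\odot^j$-independent for all $j\in[d]$, where $\mathcal S_\odot^j$ is the spreadability system for $(\mathcal A,\varphi^j)$ constructed from $\odot$.
   Context: Ordered set partitions. $\mathbb N=\{1,2,\dots\}$, $[n]=\{1,\dots,n\}$. $\mathcal P_n$ is the set of set partitions of $[n]$, ordered by refinement. An ordered set partition of $[n]$ is a sequence $\pi=(P_1,\dots,P_p)$ of pairwise disjoint nonempty blocks with union $[n]$; $\mathcal{OP}_n$ is the set of them; $\bar\pi\in\mathcal P_n$ is the underlying set partition. The quasi-meet of $\pi=(P_1,\dots,P_p)$ and $\sigma=(S_1,\dots,S_s)$ is $\pi\curlywedge\sigma=(P_1\cap S_1,P_1\cap S_2,\dots,P_1\cap S_s,P_2\cap S_1,\dots,P_p\cap S_s)$ with empty sets removed. The ordered kernel $\kappa(i_1,\dots,i_n)\in\mathcal{OP}_n$ has as blocks the level sets $\{k:i_k=v\}$ listed in increasing order of $v$. For $P=\{p_1<\dots<p_k\}$, $X_P=X_{p_1}\cdots X_{p_k}$. Universal products. Algebras are associative over $\mathbb C$, not necessarily unital; $\sqcup$ is the coproduct (nonunital free product). Objects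 of $\mathrm{AlgP}_d$ are pairs $(\mathcal A,\varphi)$, $\varphi=(\varphi^1,\dots,\varphi^d)$ a $d$-tuple of linear functionals $\mathcal A\to\mathbb C$; arrows $f:(\mathcal D,\psi)\to(\mathcal A,\varphi)$ are algebra homomorphisms with $\varphi^i\circ f=\psi^i$ for all $i$. A universal product is a bifunctor $(\mathcal A_1,\varphi_1)\odot(\mathcal A_2,\varphi_2)=(\mathcal A_1\sqcup\mathcal A_2,\varphi_1\odot\varphi_2)$, i.e. $(\varphi_1\odot\varphi_2)\circ(f_1\sqcup f_2)=(\varphi_1\circ f_1)\odot(\varphi_2\circ f_2)$ for all homomorphisms $f_k:\mathcal D_k\to\mathcal A_k$. Conditions: (U1) $(\varphi_1\odot\varphi_2)\circ\iota_k=\varphi_k$ for the canonical embeddings $\iota_k:\mathcal A_k\to\mathcal A_1\sqcup\mathcal A_2$, $k=1,2$. (U2) Associativity: $(\varphi_1\odot\varphi_2)\odot\varphi_3=\varphi_1\odot(\varphi_2\odot\varphi_3)$ under the natural isomorphism; thus $\bigodot_{i\in[p]}\varphi_i$ is defined on $\bigsqcup_{i\in[p]}\mathcal A_i$. (U6) Universal coefficients: there are complex numbers $u^j(\sigma,f;\pi)$ ($j\in[d]$, $n\in\mathbb N$, $\pi\in\mathcal{OP}_n$, $\sigma\in\mathcal P_n$, $\sigma\le\bar\pi$, $f:\sigma\to[d]$) such that for all $p$, $(\mathcal A_i,\varphi_i)\in\mathrm{AlgP}_d$ $(i\in[p])$, $n$, $i_1,\dots,i_n\in[p]$, $X_k\in\mathcal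 A_{i_k}$, $j\in[d]$, $$\Big(\bigodot_{i\in[p]}\varphi_i\Big)^j(X_1\cdots X_n)=\sum_{\sigma\in\mathcal P_n,\sigma\le\bar\pi}\ \sum_{f:\sigma\to[d]}u^j(\sigma,f;\pi)\prod_{S\in\sigma}\varphi_{i(S)}^{f(S)}(X_S),$$ with $\pi=\kappa(i_1,\dots,i_n)$ and $i(S)$ the common value of $i_k$, $k\in S$. $\odot$-independence. A sequence $(\mathcal A_i)_{i\in[p]}$ of subalgebras of $\mathcal A$ is $\odot$-independent if $\varphi^j\circ\gamma=\big[\bigodot_{i\in[p]}(\varphi\circ\gamma_i)\big]^j$ on $\bigsqcup_{i\in[p]}\mathcal A_i$ for all $j\in[d]$, where $\gamma_i:\mathcal A_i\hookrightarrow\mathcal A$ are the inclusions and $\gamma:\bigsqcup_{i}\mathcal A_i\to\mathcal A$ the canonical homomorphism they induce. A family indexed by a totally ordered set is $\odot$-independent if every finite subfamily (with the induced order) is. The system $\mathcal S_\odot^j$. Take copies $(\mathcal A_{(i)},\varphi_{(i)})=(\mathcal A,\varphi)$, $i\in\mathbb N$, $\mathcal U=\bigsqcup_{i=1}^\infty\mathcal A_{(i)}$, $\tilde\varphi^j=(\bigodot_{i\in\mathbb N}\varphi_{(i)})^j$, $\iota^{(i)}:\mathcal A=\mathcal A_{(i)}\to\mathcal U$ the natural embeddings, $\mathcal S^j_\odot=(\mathcal U,\tilde\varphi^j,(\iota^{(i)})_{i\ge1})$. Write $X^{(i)}=\iota^{(i)}(X)$. For $\pi\in\mathcal{OP}_n$,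 $\varphi^j_\pi(X_1,\dots,X_n)=\tilde\varphi^j(X_1^{(i_1)}\cdots X_n^{(i_n)})$ for any indices with $\kappa(i_1,\dots,i_n)=\pi$ (well defined). $\mathcal S_\odot^j$-independence. $(\mathcal A_i)_{i\in I}$ is $\mathcal S_\odot^j$-independent if for any $n$, $(i_1,\dots,i_n)\in I^n$, $X_k\in\mathcal A_{i_k}$ and $\pi\in\mathcal{OP}_n$: $\varphi^j_\pi(X_1,\dots,X_n)=\varphi^j_{\pi\curlywedge\kappa(i_1,\dots,i_n)}(X_1,\dots,X_n)$. *)

(* Defs.v *)
From HB Require Import structures.
From mathcomp Require Import boolp classical_sets.
From mathcomp Require Import all_boot all_order all_algebra generic_quotient.

Set Implicit Arguments.
Unset Strict Implicit.
Unset Printing Implicit Defensive.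
Import Order.TTheory GRing.Theory Num.Theory.
Local Open Scope ring_scope.
Local Open Scope quotient_scope.

(** * Associative, not necessarily unital, algebras *)

HB.mixin Record Lmodule_isNuAlgebra (K : pzRingType) A of GRing.Lmodule K A := {
  nmul : A -> A -> A;
  nmulA : associative nmul;
  nmulDl : left_distributive nmul +%R;
  nmulDr : right_distributive nmul +%R;
  nscaleAl : forall (c : K) (x y : A), c *: nmul x y = nmul (c *: x) y;
  nscaleAr : forall (c : K) (x y : A), c *: nmul x y = nmul x (c *: y)
}.

#[short(type="nuAlgType")]
HB.structure Definition NuAlgebra (K : pzRingType) :=
  {A of Lmodule_isNuAlgebra K A & GRing.Lmodule K A}.

Record nuhom (K : pzRingType) (A B : nuAlgType K) := NuHom {
  nuhom_linear :> {linear A -> B};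
  nuhomM : {morph nuhom_linear : x y / nmul x y}
}.

(* X_1 ... X_n for a nonempty sequence; the empty product does not exist in a
   nonunital algebra and is never used. *)
Definition nuprod (K : pzRingType) (A : nuAlgType K) (s : seq A) : A :=
  if s is x :: s' then foldl nmul x s' else 0.

Section HomOps.
Variable K : fieldType.
Implicit Types A B C : nuAlgType K.

Lemma nuhom_id_morph A : {morph (idfun : {linear A -> A}) : x y / nmul x y}.
Proof. by []. Qed.
Definition nuhom_id A : nuhom A A := NuHom (@nuhom_id_morph A).

Lemma nuhom_comp_morph A B C (g : nuhom B C) (f : nuhom A B) :
  {morph (g \o f : {linear A -> C}) : x y / nmul x y}.
Proof. by move=> x y /=; rewrite !nuhomM. Qed.
Definition nuhom_comp A B C (g : nuhom B C) (f : nuhom A B) : nuhom A C :=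
  NuHom (nuhom_comp_morph g f).

Lemma nuhom_compE A B C (g : nuhom B C) (f : nuhom A B) x :
  nuhom_comp g f x = g (f x).
Proof. by []. Qed.
Lemma nuhom_idE A x : nuhom_id A x = x.
Proof. by []. Qed.

Lemma nmul0l A (x : A) : nmul 0 x = 0.
Proof. by rewrite -[X in nmul X _](scale0r (0 : A)) -nscaleAl scale0r. Qed.

Lemma nuhom0_morph A B : {morph (\0 : {linear A -> B}) : x y / nmul x y}.
Proof. by move=> x y /=; rewrite nmul0l. Qed.
Definition nuhom0 A B : nuhom A B := NuHom (@nuhom0_morph A B).

Definition scalar_comp A B (phi : {scalar B}) (f : nuhom A B) : {scalar A} :=
  phi \o f.

Lemma scalar_compE A B (phi : {scalar B}) (f : nuhom A B) x :
  scalar_comp phi f x = phi (f x).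
Proof. by []. Qed.

Lemma nuprod_hom A B (f : nuhom A B) (s : seq A) :
  f (nuprod s) = nuprod (map f s).
Proof.
case: s => [|x s] /=; first exact: linear0.
by elim: s x => //= y s IH x; rewrite IH nuhomM.
Qed.

End HomOps.

(** * The coproduct (nonunital free product) of a family of algebras *)

(* Presented by generators (the elements of the A i) and relations; copair,
   copair_inj and coprod_ext give the universal property. *)
Section Coproduct.
Variables (K : fieldType) (I : Type) (A : I -> nuAlgType K).

Inductive cterm :=
| CInj i of A i
| CZero
| CAdd of cterm & cterm
| CScale of K & cterm
| CMul of cterm & cterm.

Inductive ceq : cterm -> cterm -> Prop :=
| ceq_refl s : ceq s s
| ceq_sym s t : ceq s t -> ceq t s
| ceq_trans s t u : ceq s t -> ceq t u -> ceq s u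
| ceq_add s s' t t' : ceq s s' -> ceq t t' -> ceq (CAdd s t) (CAdd s' t')
| ceq_scale c s s' : ceq s s' -> ceq (CScale c s) (CScale c s')
| ceq_mul s s' t t' : ceq s s' -> ceq t t' -> ceq (CMul s t) (CMul s' t')
| ceq_addA s t u : ceq (CAdd s (CAdd t u)) (CAdd (CAdd s t) u)
| ceq_addC s t : ceq (CAdd s t) (CAdd t s)
| ceq_add0 s : ceq (CAdd CZero s) s
| ceq_addN s : ceq (CAdd (CScale (- 1) s) s) CZero
| ceq_scaleA c d s : ceq (CScale c (CScale d s)) (CScale (c * d) s)
| ceq_scale1 s : ceq (CScale 1 s) s
| ceq_scaleDr c s t :
    ceq (CScale c (CAdd s t)) (CAdd (CScale c s) (CScale c t))
| ceq_scaleDl c d s :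
    ceq (CScale (c + d) s) (CAdd (CScale c s) (CScale d s))
| ceq_mulA s t u : ceq (CMul s (CMul t u)) (CMul (CMul s t) u)
| ceq_mulDl s t u : ceq (CMul (CAdd s t) u) (CAdd (CMul s u) (CMul t u))
| ceq_mulDr s t u : ceq (CMul s (CAdd t u)) (CAdd (CMul s t) (CMul s u))
| ceq_scaleAl c s t : ceq (CScale c (CMul s t)) (CMul (CScale c s) t)
| ceq_scaleAr c s t : ceq (CScale c (CMul s t)) (CMul s (CScale c t))
| ceq_injD i (a b : A i) : ceq (CInj (a + b)) (CAdd (CInj a) (CInj b))
| ceq_injZ i c (a : A i) : ceq (CInj (c *: a)) (CScale c (CInj a))
| ceq_injM i (a b : A i) : ceq (CInj (nmul a b)) (CMul (CInj a) (CInj b)).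

HB.instance Definition _ := gen_eqMixin cterm.
HB.instance Definition _ := gen_choiceMixin cterm.

Definition ceqb : rel cterm := fun s t => `[< ceq s t >].

Lemma ceqb_equiv : equiv_class_of ceqb.
Proof.
split=> [s|s t|t s u].
- exact/asboolP/ceq_refl.
- by apply/asboolP/asboolP; exact: ceq_sym.
- by move=> /asboolP st /asboolP tu; apply/asboolP/(ceq_trans st tu).
Qed.
Canonical ceqb_equivRel := EquivRelPack ceqb_equiv.

Definition coprod := {eq_quot ceqb}.
HB.instance Definition _ := Choice.on coprod.
HB.instance Definition _ := EqQuotient.on coprod.

Let cpi (s : cterm) : coprod := \pi_coprod s.

Let cpiP s t : cpi s = cpi t <-> ceq s t.
Proof. by split=> [/eqquotP/asboolP|/asboolP st] //; apply/eqquotP. Qed.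

Let reprP s : ceq (repr (cpi s)) s.
Proof. by apply/cpiP; rewrite /cpi reprK. Qed.

Definition cadd (x y : coprod) := cpi (CAdd (repr x) (repr y)).
Definition copp (x : coprod) := cpi (CScale (- 1) (repr x)).
Definition cscale (c : K) (x : coprod) := cpi (CScale c (repr x)).
Definition cmul (x y : coprod) := cpi (CMul (repr x) (repr y)).
Definition czero := cpi CZero.

Let caddE s t : cadd (cpi s) (cpi t) = cpi (CAdd s t).
Proof. by apply/cpiP/ceq_add; exact: reprP. Qed.
Let cmulE s t : cmul (cpi s) (cpi t) = cpi (CMul s t).
Proof. by apply/cpiP/ceq_mul; exact: reprP. Qed.
Let cscaleE c s : cscale c (cpi s) = cpi (CScale c s).
Proof. by apply/cpiP/ceq_scale; exact: reprP. Qed.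
Let coppE s : copp (cpi s) = cpi (CScale (- 1) s).
Proof. exact: cscaleE. Qed.

Let cE := (caddE, cmulE, cscaleE, coppE).

Let cpiW (P : coprod -> Prop) : (forall s, P (cpi s)) -> forall x, P x.
Proof. by move=> Ps x; rewrite -[x]reprK. Qed.

Fact caddA : associative cadd.
Proof.
by elim/cpiW=> s; elim/cpiW=> t; elim/cpiW=> u; rewrite !cE; apply/cpiP/ceq_addA.
Qed.
Fact caddC : commutative cadd.
Proof. by elim/cpiW=> s; elim/cpiW=> t; rewrite !cE; apply/cpiP/ceq_addC. Qed.
Fact cadd0 : left_id czero cadd.
Proof. by elim/cpiW=> s; rewrite !cE; apply/cpiP/ceq_add0. Qed.
Fact caddN : left_inverse czero copp cadd.
Proof. by elim/cpiW=> s; rewrite !cE; apply/cpiP/ceq_addN. Qed.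

HB.instance Definition _ := GRing.isZmodule.Build coprod caddA caddC cadd0 caddN.

Fact cscaleA c d (x : coprod) : cscale c (cscale d x) = cscale (c * d) x.
Proof. by elim/cpiW: x => s; rewrite !cE; apply/cpiP/ceq_scaleA. Qed.
Fact cscale1 : left_id 1 cscale.
Proof. by elim/cpiW=> s; rewrite !cE; apply/cpiP/ceq_scale1. Qed.
Fact cscaleDr : right_distributive cscale +%R.
Proof.
by move=> c; elim/cpiW=> s; elim/cpiW=> t; rewrite -[+%R]/cadd !cE;
  apply/cpiP/ceq_scaleDr.
Qed.
Fact cscaleDl (x : coprod) : {morph cscale^~ x : c d / c + d}.
Proof.
by elim/cpiW: x => s c d; rewrite -[RHS]/(cadd _ _) !cE; apply/cpiP/ceq_scaleDl.
Qed.

HB.instance Definition _ :=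
  GRing.Zmodule_isLmodule.Build K coprod cscaleA cscale1 cscaleDr cscaleDl.

Fact cmulA : associative cmul.
Proof.
by elim/cpiW=> s; elim/cpiW=> t; elim/cpiW=> u; rewrite !cE; apply/cpiP/ceq_mulA.
Qed.
Fact cmulDl : left_distributive cmul +%R.
Proof.
by elim/cpiW=> s; elim/cpiW=> t; elim/cpiW=> u; rewrite -[+%R]/cadd !cE;
  apply/cpiP/ceq_mulDl.
Qed.
Fact cmulDr : right_distributive cmul +%R.
Proof.
by elim/cpiW=> s; elim/cpiW=> t; elim/cpiW=> u; rewrite -[+%R]/cadd !cE;
  apply/cpiP/ceq_mulDr.
Qed.
Fact cscaleAl (c : K) (x y : coprod) : c *: cmul x y = cmul (c *: x) y.
Proof.
elim/cpiW: x => s; elim/cpiW: y => t; rewrite -![_ *: _]/(cscale _ _) !cE.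
exact/cpiP/ceq_scaleAl.
Qed.
Fact cscaleAr (c : K) (x y : coprod) : c *: cmul x y = cmul x (c *: y).
Proof.
elim/cpiW: x => s; elim/cpiW: y => t; rewrite -![_ *: _]/(cscale _ _) !cE.
exact/cpiP/ceq_scaleAr.
Qed.

HB.instance Definition _ := Lmodule_isNuAlgebra.Build K coprod
  cmulA cmulDl cmulDr cscaleAl cscaleAr.

Section Injection.
Variable i : I.
Definition cinj_fun (a : A i) : coprod := cpi (CInj a).
Fact cinj_linear : linear cinj_fun.
Proof.
move=> c a b; rewrite -[_ *: cinj_fun _]/(cscale _ _) -[RHS]/(cadd _ _).
rewrite /cinj_fun !cE; apply/cpiP.
by apply: (ceq_trans (ceq_injD _ _)); apply: ceq_add; [exact: ceq_injZ|exact: ceq_refl].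
Qed.
HB.instance Definition _ :=
  GRing.isLinear.Build K (A i) coprod *:%R cinj_fun cinj_linear.
Fact cinj_morph : {morph (cinj_fun : {linear A i -> coprod}) : x y / nmul x y}.
Proof.
by move=> a b /=; rewrite -[RHS]/(cmul _ _) /cinj_fun cE; apply/cpiP/ceq_injM.
Qed.
Definition cinj : nuhom (A i) coprod := NuHom cinj_morph.
End Injection.

Lemma coprod_ind (P : coprod -> Prop) :
  (forall i a, P (cinj i a)) -> P 0 -> (forall x y, P x -> P y -> P (x + y)) ->
  (forall c x, P x -> P (c *: x)) ->
  (forall x y, P x -> P y -> P (nmul x y)) -> forall x, P x.
Proof.
move=> Pi P0 PD PZ PM; elim/cpiW; elim=> [i a||s Ps t Pt|c s Ps|s Ps t Pt].
- exact: Pi.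
- exact: P0.
- by rewrite -caddE; exact: PD.
- by rewrite -cscaleE; exact: PZ.
- by rewrite -cmulE; exact: PM.
Qed.

Section Copair.
Variables (B : nuAlgType K) (f : forall i, nuhom (A i) B).

Fixpoint ceval (s : cterm) : B := match s with
  | CInj i a => f i a
  | CZero => 0
  | CAdd s t => ceval s + ceval t
  | CScale c s => c *: ceval s
  | CMul s t => nmul (ceval s) (ceval t)
  end.

Lemma ceval_eq s t : ceq s t -> ceval s = ceval t.
Proof.
elim=> {s t} /=; do ?[by move=> *; congruence].
- by move=> *; rewrite addrA.
- by move=> *; rewrite addrC.
- by move=> *; rewrite add0r.
- by move=> s; rewrite scaleN1r addNr.
- by move=> *; rewrite scalerA.
- by move=> *; rewrite scale1r.
- by move=> *; rewrite scalerDr.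
- by move=> *; rewrite scalerDl.
- by move=> *; rewrite nmulA.
- by move=> *; rewrite nmulDl.
- by move=> *; rewrite nmulDr.
- by move=> *; rewrite nscaleAl.
- by move=> *; rewrite nscaleAr.
- by move=> *; rewrite linearD.
- by move=> *; rewrite linearZ.
- by move=> *; rewrite nuhomM.
Qed.

Definition copair_fun (x : coprod) : B := ceval (repr x).
Let copair_pi s : copair_fun (cpi s) = ceval s.
Proof. exact/ceval_eq/reprP. Qed.

Fact copair_linear : linear copair_fun.
Proof.
move=> c x y; elim/cpiW: x => s; elim/cpiW: y => t.
by rewrite -[_ *: cpi _]/(cscale _ _) -[X in copair_fun X]/(cadd _ _) !cE !copair_pi.
Qed.
HB.instance Definition _ :=
  GRing.isLinear.Build K coprod B *:%R copair_fun copair_linear.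
Fact copair_morph : {morph (copair_fun : {linear coprod -> B}) : x y / nmul x y}.
Proof.
move=> x y /=; elim/cpiW: x => s; elim/cpiW: y => t.
by rewrite -[X in copair_fun X]/(cmul _ _) cE !copair_pi.
Qed.
Definition copair : nuhom coprod B := NuHom copair_morph.

Lemma copair_inj i a : copair (cinj i a) = f i a.
Proof. exact: copair_pi. Qed.
End Copair.

Lemma coprod_ext (B : nuAlgType K) (g h : nuhom coprod B) :
  (forall i a, g (cinj i a) = h (cinj i a)) -> g =1 h.
Proof.
move=> gh; apply: coprod_ind => //.
- by rewrite !linear0.
- by move=> x y gx gy; rewrite !linearD gx gy.
- by move=> c x gx; rewrite !linearZ gx.
- by move=> x y gx gy; rewrite !nuhomM gx gy.
Qed.

End Coproduct.

Arguments cinj {K I} A i.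
Arguments copair {K I A B} f.

Section BinaryCoproduct.
Variable K : fieldType.
Implicit Types A B : nuAlgType K.

Definition coprod2 A B : nuAlgType K := coprod (fun b : bool => if b then B else A).
Definition cinl A B : nuhom A (coprod2 A B) := cinj (fun b => if b then B else A) false.
Definition cinr A B : nuhom B (coprod2 A B) := cinj (fun b => if b then B else A) true.

Definition copair2 A B (C : nuAlgType K) (f : nuhom A C) (g : nuhom B C) :
    nuhom (coprod2 A B) C :=
  copair (A := fun b : bool => if b then B else A)
    (fun b => if b return nuhom (if b then B else A) C then g else f).

Lemma copair2_inl A B C (f : nuhom A C) (g : nuhom B C) a :
  copair2 f g (cinl A B a) = f a.
Proof. exact: (copair_inj _ (i := false)). Qed.
Lemma copair2_inr A B C (f : nuhom A C) (g : nuhom B C) b :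
  copair2 f g (cinr A B b) = g b.
Proof. exact: (copair_inj _ (i := true)). Qed.

Lemma coprod2_ext A B C (g h : nuhom (coprod2 A B) C) :
  (forall a, g (cinl A B a) = h (cinl A B a)) ->
  (forall b, g (cinr A B b) = h (cinr A B b)) -> g =1 h.
Proof. by move=> gh1 gh2; apply: coprod_ext; case=> a. Qed.

Definition coprod2_map A1 A2 B1 B2 (f : nuhom A1 B1) (g : nuhom A2 B2) :
    nuhom (coprod2 A1 A2) (coprod2 B1 B2) :=
  copair2 (nuhom_comp (cinl B1 B2) f) (nuhom_comp (cinr B1 B2) g).

Definition coprod2_assoc A1 A2 A3 :
    nuhom (coprod2 (coprod2 A1 A2) A3) (coprod2 A1 (coprod2 A2 A3)) :=
  copair2
    (copair2 (cinl A1 (coprod2 A2 A3))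
             (nuhom_comp (cinr A1 (coprod2 A2 A3)) (cinl A2 A3)))
    (nuhom_comp (cinr A1 (coprod2 A2 A3)) (cinr A2 A3)).

End BinaryCoproduct.

(** * Ordered set partitions *)

Section OrderedSetPartitions.
Variable n : nat.

Definition is_osp (s : seq {set 'I_n}) : bool :=
  [&& all (fun P : {set 'I_n} => P != set0) s, pairwise (fun P Q : {set 'I_n} => [disjoint P & Q]) s
    & \bigcup_(P <- s) P == [set: 'I_n]].

Record osp := Osp { osp_blocks :> seq {set 'I_n}; osp_blocksP : is_osp osp_blocks }.
HB.instance Definition _ := [isSub for osp_blocks].
HB.instance Definition _ := [Equality of osp by <:].

Definition osp_underlying (pi : osp) : {set {set 'I_n}} := [set P in osp_blocks pi].

Definition refines (sigma tau : {set {set 'I_n}}) : bool :=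
  [forall B in sigma, exists P in tau, B \subset P].

Definition quasi_meet_seq (s t : seq {set 'I_n}) : seq {set 'I_n} :=
  [seq R <- [seq P :&: Q | P <- s, Q <- t] | R != set0].

Definition kappa_seq (i : 'I_n -> nat) : seq {set 'I_n} :=
  [seq [set k | i k == v] | v <- sort leq (undup (codom i))].

(* Position (from 0) of the block of pi containing k. *)
Definition block_index (pi : osp) (k : 'I_n) : nat :=
  find (fun P : {set 'I_n} => k \in P) pi.

Lemma bigcup_seqP (s : seq {set 'I_n}) k :
  reflect (exists2 P, P \in s & k \in P) (k \in \bigcup_(P <- s) P).
Proof.
elim: s => [|P s IH]; first by rewrite big_nil inE; constructor; case.
rewrite big_cons inE; case: (boolP (k \in P)) => kP /=.
  by constructor; exists P; rewrite ?mem_head.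
apply: (iffP IH) => [[Q Qs kQ]|[Q]]; first by exists Q; rewrite // inE Qs orbT.
by rewrite inE => /orP[/eqP-> /(negP kP)|Qs kQ] //; exists Q.
Qed.

Lemma bigcup_seqT (s : seq {set 'I_n}) :
  (\bigcup_(P <- s) P == [set: 'I_n]) = [forall k, has (fun P : {set 'I_n} => k \in P) s].
Proof.
apply/eqP/forallP => [sT k|sT].
  by have := in_setT k; rewrite -sT => /bigcup_seqP[P Ps kP]; apply/hasP; exists P.
by apply/setP=> k; rewrite inE; apply/bigcup_seqP/hasP/sT.
Qed.

Lemma disj_sub (P Q P' Q' : {set 'I_n}) :
  P' \subset P -> Q' \subset Q -> [disjoint P & Q] -> [disjoint P' & Q'].
Proof. by move=> sP sQ; move/(disjointWl sP)/(disjointWr sQ). Qed.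

Lemma quasi_meet_is_osp s t : is_osp s -> is_osp t -> is_osp (quasi_meet_seq s t).
Proof.
move=> /and3P[_ ds cs] /and3P[_ dt ct].
rewrite /is_osp /quasi_meet_seq /=; apply/and3P; split.
- by apply/allP => P; rewrite mem_filter => /andP[].
- apply: pairwise_filter; elim: s ds {cs} => //= P s IH /andP[/allP Ps ds].
  rewrite pairwise_cat IH // andbT; apply/andP; split.
    apply/allrelP => _ _ /mapP[S St ->] /allpairsP[[P' S'] [/= P's S't ->]].
    by apply: disj_sub (Ps _ P's); exact: subsetIl.
  rewrite pairwise_map; apply: sub_pairwise dt => S S' /=.
  by apply: disj_sub; exact: subsetIr.
- move: cs ct; rewrite !bigcup_seqT => /forallP cs /forallP ct; apply/forallP => k.
  have /hasP[P Ps kP] := cs k; have /hasP[S St kS] := ct k.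
  apply/hasP; exists (P :&: S); last by rewrite inE kP.
  rewrite mem_filter; apply/andP; split; last by apply/allpairsP; exists (P, S).
  by apply/set0Pn; exists k; rewrite inE kP.
Qed.
Definition quasi_meet (pi sigma : osp) : osp :=
  Osp (quasi_meet_is_osp (osp_blocksP pi) (osp_blocksP sigma)).

Fact kappa_osp i : is_osp (kappa_seq i).
Proof.
rewrite /is_osp /kappa_seq; apply/and3P; split.
- apply/allP => _ /mapP[v + ->]; rewrite mem_sort mem_undup => /codomP[k ->].
  by apply/set0Pn; exists k; rewrite inE.
- rewrite pairwise_map.
  have : uniq (sort leq (undup (codom i))) by rewrite sort_uniq undup_uniq.
  rewrite uniq_pairwise; apply: sub_pairwise => v w /= vw.
  apply/pred0P => k /=; rewrite !inE; apply/negbTE/negP => /andP[/eqP iv /eqP iw].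
  by rewrite -iv -iw eqxx in vw.
- rewrite bigcup_seqT; apply/forallP => k; apply/hasP; exists [set l | i l == i k].
    by apply/map_f; rewrite mem_sort mem_undup codom_f.
  by rewrite inE.
Qed.
Definition kappa i : osp := Osp (kappa_osp i).

Lemma block_index_lt (pi : osp) k : (block_index pi k < size pi)%N.
Proof.
by case: pi => s sP; case/and3P: (sP) => _ _; rewrite bigcup_seqT -has_find => /forallP.
Qed.

Lemma nth_block_index (pi : osp) m k : (m < size pi)%N ->
  (k \in nth set0 pi m) = (block_index pi k == m).
Proof.
move=> mpi; have bl := block_index_lt pi k.
have kb : k \in nth set0 pi (block_index pi k).
  by apply: (@nth_find _ set0 (fun P : {set 'I_n} => k \in P)); rewrite has_find.
apply/idP/eqP => [km|<- //]; apply/eqP; apply: contraT => ne.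
case: pi mpi bl kb km ne => s sP; case/and3P: (sP) => _ /(pairwiseP set0) ds _ /=.
move=> mpi bl kb km; case: ltngtP => // lt _.
  by have /pred0P/(_ k) := ds _ _ bl mpi lt; rewrite /= kb km.
by have /pred0P/(_ k) := ds _ _ mpi bl lt; rewrite /= kb km.
Qed.

Lemma kappa_block_index (pi : osp) : kappa (block_index pi) = pi.
Proof.
apply/val_inj => /=; rewrite /kappa_seq.
suff -> : sort leq (undup (codom (block_index pi))) = iota 0 (size pi).
  apply: (@eq_from_nth _ set0); rewrite size_map size_iota // => m mpi.
  rewrite (nth_map 0) ?size_iota // nth_iota // add0n; apply/setP => k.
  by rewrite inE nth_block_index.
apply: (sorted_eq leq_trans anti_leq); rewrite ?iota_sorted ?sort_sorted //;
  try exact: leq_total.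
apply: uniq_perm; rewrite ?sort_uniq ?undup_uniq ?iota_uniq // => m.
rewrite mem_sort mem_undup mem_iota add0n /=; apply/codomP/idP => [[k ->]|mpi].
  exact: block_index_lt.
have /set0Pn[k km] : nth set0 pi m != set0.
  case: pi mpi => s sP; case/and3P: (sP) => /allP s0 _ _ /= mpi.
  exact/s0/mem_nth.
by exists k; apply/esym/eqP; rewrite -nth_block_index.
Qed.

End OrderedSetPartitions.

(** * Universal products *)

Definition ordS_case (n : nat) (P : 'I_n.+1 -> Type) (P0 : P ord0)
    (PS : forall j, P (lift ord0 j)) (i : 'I_n.+1) : P i :=
  match unliftP ord0 i with
  | UnliftSome j e => ecast k (P k) (esym e) (PS j)
  | UnliftNone e => ecast k (P k) (esym e) P0
  end.

Lemma ordS_case0 n P P0 PS : @ordS_case n P P0 PS ord0 = P0.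
Proof.
rewrite /ordS_case; case: unliftP => [j e|e]; last by rewrite eq_axiomK.
by exfalso; have := neq_lift ord0 j; rewrite -e eqxx.
Qed.

Lemma ordS_caseS n P P0 PS j : @ordS_case n P P0 PS (lift ord0 j) = PS j.
Proof.
rewrite /ordS_case; case: unliftP => [k e|e]; last first.
  by exfalso; have := neq_lift ord0 j; rewrite e eqxx.
by have jk := lift_inj e; move: e; rewrite -jk => e; rewrite eq_axiomK.
Qed.

Section UniversalProduct.
Variables (K : fieldType) (d : nat).
Implicit Types A B D : nuAlgType K.

Definition algP_arrow D A (psi : 'I_d -> {scalar D}) (phi : 'I_d -> {scalar A})
    (f : nuhom D A) : Prop :=
  forall j x, phi j (f x) = psi j x.

Record universal_product := UniversalProduct {
  odot : forall A1 A2, ('I_d -> {scalar A1}) -> ('I_d -> {scalar A2}) ->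
    'I_d -> {scalar coprod2 A1 A2};
  odot_natural : forall D1 D2 A1 A2
    (psi1 : 'I_d -> {scalar D1}) (psi2 : 'I_d -> {scalar D2})
    (phi1 : 'I_d -> {scalar A1}) (phi2 : 'I_d -> {scalar A2})
    (f1 : nuhom D1 A1) (f2 : nuhom D2 A2),
    algP_arrow psi1 phi1 f1 -> algP_arrow psi2 phi2 f2 ->
    algP_arrow (odot psi1 psi2) (odot phi1 phi2) (coprod2_map f1 f2)
}.

Variable P : universal_product.

Definition U1 : Prop := forall A1 A2
  (phi1 : 'I_d -> {scalar A1}) (phi2 : 'I_d -> {scalar A2}) j,
  (forall x, odot P phi1 phi2 j (cinl A1 A2 x) = phi1 j x) /\
  (forall y, odot P phi1 phi2 j (cinr A1 A2 y) = phi2 j y).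

Definition U2 : Prop := forall A1 A2 A3
  (phi1 : 'I_d -> {scalar A1}) (phi2 : 'I_d -> {scalar A2})
  (phi3 : 'I_d -> {scalar A3}) j x,
  odot P phi1 (odot P phi2 phi3) j (coprod2_assoc A1 A2 A3 x) =
  odot P (odot P phi1 phi2) phi3 j x.

Definition coprod_collapse (A : 'I_1 -> nuAlgType K) :
    nuhom (coprod A) (A ord0) :=
  copair (ordS_case (P := fun i => nuhom (A i) (A ord0))
    (nuhom_id (A ord0)) (fun j : 'I_0 => nuhom0 (A (lift ord0 j)) (A ord0))).

Definition coprod_split p (A : 'I_p.+2 -> nuAlgType K) :
    nuhom (coprod A)
      (coprod2 (A ord0) (coprod (fun i : 'I_p.+1 => A (lift ord0 i)))) :=
  copair (ordS_case
    (P := fun i => nuhom (A i)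
      (coprod2 (A ord0) (coprod (fun i : 'I_p.+1 => A (lift ord0 i)))))
    (cinl _ _)
    (fun j => nuhom_comp (cinr _ _) (cinj (fun i : 'I_p.+1 => A (lift ord0 i)) j))).

(* The product of p + 1 factors, bracketed to the right and transported to the
   coproduct of the family; by associativity the bracketing is immaterial. *)
Fixpoint odot_fin (p : nat) : forall A : 'I_p.+1 -> nuAlgType K,
    (forall i, 'I_d -> {scalar A i}) -> 'I_d -> {scalar coprod A} :=
  match p with
  | 0 => fun (A : 'I_1 -> _) phi j => scalar_comp (phi ord0 j) (coprod_collapse A)
  | p'.+1 => fun (A : 'I_p'.+2 -> _) phi j =>
      scalar_comp
        (odot P (phi ord0) (odot_fin (fun i : 'I_p'.+1 => phi (lift ord0 i))) j)
        (coprod_split A)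
  end.

Section Word.
Variables (I : eqType) (A : I -> nuAlgType K) (n : nat).

(* X k, of type {i : I & A i}, is an element of the algebra A (tag (X k)). *)
Definition word (X : 'I_n -> {i : I & A i}) : coprod A :=
  nuprod [seq cinj A (tag (X k)) (tagged (X k)) | k <- enum 'I_n].

(* phi_{i(S)}^r (X_S) for a block S on which i_k = tag (X k) is constant: there
   tagged_as is a cast to the common algebra A i(S).  enum S is increasing. *)
Definition block_value (phi : forall i, 'I_d -> {scalar A i})
    (X : 'I_n -> {i : I & A i}) (r : 'I_d) (S : {set 'I_n}) : K :=
  if [pick k in S] is Some k then
    phi (tag (X k)) r (nuprod [seq tagged_as (X k) (X l) | l <- enum S])
  else 0.

End Word.

Definition U6 : Prop :=
  exists u : 'I_d -> forall (n : nat) (sigma : {set {set 'I_n}}),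
      {ffun {S : {set 'I_n} | S \in sigma} -> 'I_d} -> osp n -> K,
  forall p (A : 'I_p.+1 -> nuAlgType K) (phi : forall i, 'I_d -> {scalar A i})
    n (X : 'I_n -> {i : 'I_p.+1 & A i}) j,
  (0 < n)%N ->
  let pi := kappa (fun k => tag (X k)) in
  odot_fin phi j (word X) =
    \sum_(sigma : {set {set 'I_n}} |
            partition sigma [set: 'I_n] && refines sigma (osp_underlying pi))
    \sum_(f : {ffun {S : {set 'I_n} | S \in sigma} -> 'I_d})
      u j n sigma f pi *
      \prod_(S : {S : {set 'I_n} | S \in sigma}) block_value phi X (f S) (val S).

End UniversalProduct.

(** * Infinite products *)

Section InfiniteProduct.
Variables (K : fieldType) (d : nat) (P : universal_product K d).

Definition coprod_incl (A : nat -> nuAlgType K) p :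
    nuhom (coprod (fun i : 'I_p.+1 => A i)) (coprod A) :=
  copair (fun i : 'I_p.+1 => cinj A i).

Definition coprod_widen (A : nat -> nuAlgType K) p :
    nuhom (coprod (fun i : 'I_p.+1 => A i)) (coprod (fun i : 'I_p.+2 => A i)) :=
  copair (fun i : 'I_p.+1 =>
    cinj (fun i : 'I_p.+2 => A i) (widen_ord (leqnSn p.+1) i)).

(* Kills the factors of index > p. *)
Definition coprod_trunc (A : nat -> nuAlgType K) p :
    nuhom (coprod A) (coprod (fun i : 'I_p.+1 => A i)) :=
  copair (fun i : nat =>
    match @idP (i < p.+1)%N with
    | ReflectT ip => cinj (fun i : 'I_p.+1 => A i) (Ordinal ip)
    | ReflectF _ => nuhom0 _ _
    end).

Lemma ord_irr m (A : nat -> nuAlgType K) (B : nuAlgType K)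
    (f : forall i : 'I_m, nuhom (A i) B) v (h h' : (v < m)%N) (a : A v) :
  f (Ordinal h) a = f (Ordinal h') a.
Proof. by rewrite (bool_irrelevance h h'). Qed.

Hypothesis hU1 : U1 P.

Lemma odot_fin_widen p (A : nat -> nuAlgType K)
    (phi : forall i, 'I_d -> {scalar A i}) j x :
  odot_fin P (fun i : 'I_p.+2 => phi i) j (coprod_widen A p x) =
  odot_fin P (fun i : 'I_p.+1 => phi i) j x.
Proof.
elim: p A phi j x => [|p IH] A phi j x.
  have E : coprod_split (fun i : 'I_2 => A i) (coprod_widen A 0 x) =
      cinl _ _ (coprod_collapse (fun i : 'I_1 => A i) x).
    apply: (coprod_ext (g := nuhom_comp (coprod_split (fun i : 'I_2 => A i))
      (coprod_widen A 0)) (h := nuhom_comp (cinl _ _) (coprod_collapse _))).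
    apply: ordS_case => [a|[]//].
    rewrite !nuhom_compE /coprod_widen /coprod_collapse /coprod_split !copair_inj.
    rewrite ordS_case0 nuhom_idE.
    set f := ordS_case _ _.
    have -> : f (widen_ord (leqnSn 1) (@ord0 0)) a = f ord0 a := ord_irr f _ _ _.
    by rewrite /f ordS_case0.
  by rewrite /= E (proj1 (hU1 _ _ _)).
pose A' n := A n.+1; pose phi' n := phi n.+1.
have N := @odot_natural _ _ P _ _ _ _ (phi 0%N)
  (odot_fin P (fun i : 'I_p.+1 => phi' i)) (phi 0%N)
  (odot_fin P (fun i : 'I_p.+2 => phi' i)) (nuhom_id _) (coprod_widen A' p).
have {}N := N (fun _ _ => erefl) (fun r y => IH A' phi' r y).
have E : coprod_split (fun i : 'I_p.+3 => A i) (coprod_widen A p.+1 x) =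
    coprod2_map (nuhom_id _) (coprod_widen A' p)
      (coprod_split (fun i : 'I_p.+2 => A i) x).
  apply: (coprod_ext (g := nuhom_comp (coprod_split (fun i : 'I_p.+3 => A i))
      (coprod_widen A p.+1)) (h := nuhom_comp (coprod2_map (nuhom_id _)
      (coprod_widen A' p)) (coprod_split (fun i : 'I_p.+2 => A i)))).
  set W := coprod_widen A' p.
  apply: ordS_case => [a|i a];
    rewrite !nuhom_compE /coprod_widen /coprod_split !copair_inj;
    set f := ordS_case _ _.
    have -> : f (widen_ord (leqnSn p.+2) ord0) a = f ord0 a := ord_irr f _ _ _.
    by rewrite /f !ordS_case0 /coprod2_map copair2_inl nuhom_compE.
  have -> : f (widen_ord (leqnSn p.+2) (lift ord0 i)) a =
    f (lift ord0 (widen_ord (leqnSn p.+1) i)) a := ord_irr f _ _ _.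
  rewrite /f !ordS_caseS /coprod2_map !nuhom_compE copair2_inr nuhom_compE.
  by rewrite /W /coprod_widen copair_inj.
rewrite -[LHS]/(odot P (phi 0%N) (odot_fin P (fun i : 'I_p.+2 => phi' i)) j
  (coprod_split (fun i : 'I_p.+3 => A i) (coprod_widen A p.+1 x))).
by rewrite E N.
Qed.

Section Limit.
Variables (A : nat -> nuAlgType K) (phi : forall i, 'I_d -> {scalar A i}).

Let F p j (x : coprod A) : K :=
  odot_fin P (fun i : 'I_p.+1 => phi i) j (coprod_trunc A p x).

Lemma coprod_trunc_lt p i (a : A i) (ip : (i < p.+1)%N) :
  coprod_trunc A p (cinj A i a) = cinj (fun i : 'I_p.+1 => A i) (Ordinal ip) a.
Proof.
rewrite /coprod_trunc copair_inj.
case: {-}_ / idP => [ip'|//]; exact: ord_irr.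
Qed.

Lemma coprod_trunc_inclK p : cancel (coprod_incl A p) (coprod_trunc A p).
Proof.
apply: (coprod_ext (g := nuhom_comp (coprod_trunc A p) (coprod_incl A p))
  (h := nuhom_id _)) => -[i ip] a; rewrite ?nuhom_compE ?nuhom_idE.
by rewrite /coprod_incl copair_inj (coprod_trunc_lt _ ip).
Qed.

Lemma coprod_truncS p q w : (p <= q)%N ->
  coprod_trunc A q.+1 (coprod_incl A p w) =
  coprod_widen A q (coprod_trunc A q (coprod_incl A p w)).
Proof.
move=> pq; apply: (coprod_ext
  (g := nuhom_comp (coprod_trunc A q.+1) (coprod_incl A p))
  (h := nuhom_comp (coprod_widen A q)
    (nuhom_comp (coprod_trunc A q) (coprod_incl A p)))) => -[i ip] a; rewrite ?nuhom_compE ?nuhom_idE.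
rewrite /coprod_incl copair_inj /coprod_widen.
have iq : (i < q.+1)%N := @leq_trans p.+1 i.+1 q.+1 ip pq.
rewrite (coprod_trunc_lt _ (leqW iq)) (coprod_trunc_lt _ iq) copair_inj.
exact: (ord_irr (cinj (fun i : 'I_q.+2 => A i))).
Qed.

Lemma F_incl p q j w : (p <= q)%N ->
  F q j (coprod_incl A p w) = odot_fin P (fun i : 'I_p.+1 => phi i) j w.
Proof.
elim: q => [|q IH].
  by rewrite leqn0 => /eqP p0; subst p; rewrite /F coprod_trunc_inclK.
rewrite leq_eqVlt => /predU1P[p0|pq].
  by subst p; rewrite /F coprod_trunc_inclK.
by rewrite /F coprod_truncS // odot_fin_widen; exact: IH.
Qed.

Lemma coprod_incl_widen p w :
  coprod_incl A p.+1 (coprod_widen A p w) = coprod_incl A p w.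
Proof.
apply: (coprod_ext (g := nuhom_comp (coprod_incl A p.+1) (coprod_widen A p))
  (h := coprod_incl A p)) => i a; rewrite ?nuhom_compE ?nuhom_idE.
by rewrite /coprod_widen /coprod_incl !copair_inj.
Qed.

Lemma coprod_incl_le p q w : (p <= q)%N ->
  exists w', coprod_incl A q w' = coprod_incl A p w.
Proof.
move/subnK <-; elim: (q - p)%N => [|k [w' <-]]; first by exists w.
by exists (coprod_widen A (k + p) w'); rewrite coprod_incl_widen.
Qed.

Lemma coprod_incl_surj x : exists p w, coprod_incl A p w = x.
Proof.
have H2 (y z : coprod A) : (exists p w, coprod_incl A p w = y) ->
    (exists p w, coprod_incl A p w = z) ->
    exists p w w', coprod_incl A p w = y /\ coprod_incl A p w' = z.
  move=> [p [w <-]] [q [w' <-]]; exists (maxn p q).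
  have [v vE] := coprod_incl_le w (leq_maxl p q).
  by have [v' v'E] := coprod_incl_le w' (leq_maxr p q); exists v, v'.
move: x; apply: coprod_ind => [i a||x y Px Py|c x [p [w <-]]|x y Px Py].
- exists i, (cinj (fun j : 'I_i.+1 => A j) ord_max a).
  exact: (copair_inj _ (i := ord_max)).
- by exists 0%N, 0; rewrite linear0.
- by have [p [w [w' [<- <-]]]] := H2 _ _ Px Py; exists p, (w + w'); rewrite linearD.
- by exists p, (c *: w); rewrite linearZ.
- by have [p [w [w' [<- <-]]]] := H2 _ _ Px Py; exists p, (nmul w w'); rewrite nuhomM.
Qed.

Lemma odot_inf_ex : exists G : 'I_d -> {scalar coprod A}, forall p j w,
  G j (coprod_incl A p w) = odot_fin P (fun i : 'I_p.+1 => phi i) j w.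
Proof.
pose N x : nat := projT1 (cid (coprod_incl_surj x)).
pose g j x := F (N x) j x.
have gE p j w : g j (coprod_incl A p w) = odot_fin P (fun i : 'I_p.+1 => phi i) j w.
  rewrite /g /N; case: cid => q [w' E]; rewrite -[LHS]/(F q j _).
  by rewrite -[in LHS]E (F_incl _ _ (leqnn q)) -(F_incl _ _ (leq_maxr p q)) E
    (F_incl _ _ (leq_maxl p q)).
have glin j : linear_for *%R (g j).
  move=> c x y; have [p [w <-]] := coprod_incl_surj x.
  have [q [w' <-]] := coprod_incl_surj y.
  have [v <-] := coprod_incl_le w (leq_maxl p q).
  have [v' <-] := coprod_incl_le w' (leq_maxr p q).
  by rewrite -linearP !gE [LHS]linearP.
pose G j : {scalar coprod A} := HB.pack (g j)
  (GRing.isLinear.Build K (coprod A) K *%R (g j) (glin j)).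
by exists G => p j w; exact: gE.
Qed.

(* The product of infinitely many factors: its restriction to the coproduct of
   the first p + 1 factors is their product (odot_infE). *)
Definition odot_inf : 'I_d -> {scalar coprod A} := projT1 (cid odot_inf_ex).

Lemma odot_infE p j w : odot_inf j (coprod_incl A p w) =
  odot_fin P (fun i : 'I_p.+1 => phi i) j w.
Proof. by rewrite /odot_inf; case: cid => G /= ->. Qed.

End Limit.
End InfiniteProduct.

Lemma odot_fin_inj (K : fieldType) d (P : universal_product K d) p
    (A : 'I_p.+1 -> nuAlgType K) (phi : forall i, 'I_d -> {scalar A i}) j i a :
  U1 P -> odot_fin P phi j (cinj A i a) = phi i j a.
Proof.
move=> hU1; elim: p A phi i a => [|p IH] A phi; apply: ordS_case => [a|].
- rewrite -[LHS]/(phi ord0 j (coprod_collapse A (cinj A ord0 a))).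
  by rewrite /coprod_collapse copair_inj ordS_case0.
- by case.
- rewrite -[LHS]/(odot P _ _ j (coprod_split A (cinj A ord0 a))).
  by rewrite /coprod_split copair_inj ordS_case0 (proj1 (hU1 _ _ _ _ _)).
- move=> i a; rewrite -[LHS]/(odot P _ _ j (coprod_split A (cinj A _ a))).
  rewrite /coprod_split copair_inj ordS_caseS nuhom_compE.
  by rewrite (proj2 (hU1 _ _ _ _ _)) IH.
Qed.

Lemma tagged_as_const (I : eqType) (T : Type) (v w : {i : I & T}) :
  tag v = tag w -> tagged_as v w = tagged w.
Proof. by case: v w => i x [k y] /= ik; subst k; rewrite tagged_asE. Qed.

Lemma kappa_const n (i : 'I_n -> nat) (sigma : {set {set 'I_n}}) (Q : {set 'I_n}) k l :
  refines sigma (osp_underlying (kappa i)) -> Q \in sigma ->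
  k \in Q -> l \in Q -> i k = i l.
Proof.
move=> /forallP/(_ Q)/implyP h Qs kQ lQ.
have /existsP[R /andP[]] := h Qs; rewrite inE => /mapP[v _ ->] /fintype.subsetP sQ.
by have := sQ _ kQ; have := sQ _ lQ; rewrite !inE => /eqP-> /eqP->.
Qed.

(** * Subalgebras and independence *)

Section Subalgebra.
Variables (K : fieldType) (A : nuAlgType K).

Record subalgebra := Subalgebra {
  subalg_set :> set A;
  subalg0 : subalg_set 0;
  subalgD : forall x y, subalg_set x -> subalg_set y -> subalg_set (x + y);
  subalgZ : forall c x, subalg_set x -> subalg_set (c *: x);
  subalgM : forall x y, subalg_set x -> subalg_set y -> subalg_set (nmul x y)
}.

Variable B : subalgebra.

Definition subalg_pred : {pred A} := fun x => `[< subalg_set B x >].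
Fact subalg_pred_submod : submod_closed subalg_pred.
Proof.
split; first by apply/asboolP; exact: subalg0.
move=> c x y /asboolP Bx /asboolP By; apply/asboolP.
by apply: subalgD => //; exact: subalgZ.
Qed.
HB.instance Definition _ :=
  GRing.isSubmodClosed.Build K A subalg_pred subalg_pred_submod.

Record subalg_type := SubalgElt { subalg_val : A; subalg_valP : subalg_val \in subalg_pred }.
HB.instance Definition _ := [isSub for subalg_val].
HB.instance Definition _ := [Choice of subalg_type by <:].
HB.instance Definition _ := [SubChoice_isSubLmodule of subalg_type by <:].

Fact subalg_mul_subproof (x y : subalg_type) : nmul (val x) (val y) \in subalg_pred.
Proof.
by case: x y => x /asboolP Bx [y /asboolP By] /=; apply/asboolP; exact: subalgM.
Qed.
Definition subalg_mul (x y : subalg_type) : subalg_type :=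
  SubalgElt (subalg_mul_subproof x y).

Fact subalg_mulA : associative subalg_mul.
Proof. by move=> x y z; apply/val_inj; exact: nmulA. Qed.
Fact subalg_mulDl : left_distributive subalg_mul +%R.
Proof. by move=> x y z; apply/val_inj; exact: nmulDl. Qed.
Fact subalg_mulDr : right_distributive subalg_mul +%R.
Proof. by move=> x y z; apply/val_inj; exact: nmulDr. Qed.
Fact subalg_scaleAl (c : K) (x y : subalg_type) :
  c *: subalg_mul x y = subalg_mul (c *: x) y.
Proof. by apply/val_inj; exact: nscaleAl. Qed.
Fact subalg_scaleAr (c : K) (x y : subalg_type) :
  c *: subalg_mul x y = subalg_mul x (c *: y).
Proof. by apply/val_inj; exact: nscaleAr. Qed.
HB.instance Definition _ := Lmodule_isNuAlgebra.Build K subalg_type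
  subalg_mulA subalg_mulDl subalg_mulDr subalg_scaleAl subalg_scaleAr.

Fact subalg_incl_morph :
  {morph (val : {linear subalg_type -> A}) : x y / nmul x y}.
Proof. by []. Qed.
Definition subalg_incl : nuhom subalg_type A := NuHom subalg_incl_morph.

End Subalgebra.

Section Independence.
Variables (K : fieldType) (d : nat) (P : universal_product K d).
Variables (A : nuAlgType K) (phi : 'I_d -> {scalar A}).

Definition odot_independent_fin p (B : 'I_p.+1 -> subalgebra A) : Prop :=
  forall j (x : coprod (fun i => subalg_type (B i))),
    phi j (copair (fun i => subalg_incl (B i)) x) =
    odot_fin P (fun i r => scalar_comp (phi r) (subalg_incl (B i))) j x.

(* A nonempty finite subfamily, with the induced order, is given by a strictly
   increasing sequence of indices. *)
Definition odot_independent (I : set nat) (B : I -> subalgebra A) : Prop :=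
  forall p (t : 'I_p.+1 -> I),
    {homo t : k l / (k < l)%N >-> (val k < val l)%N} ->
    odot_independent_fin (fun k => B (t k)).

(* The triple (U, phi~, (iota^(i))_i); for S_odot the compatibility with phi and
   the spreadability of phi~ are S_odot_emb and S_odot_spreadable. *)
Record spread_system := SpreadSystem {
  spread_alg : nuAlgType K;
  spread_fun : {scalar spread_alg};
  spread_emb : nat -> nuhom A spread_alg
}.

Definition S_odot (hU1 : U1 P) (j : 'I_d) : spread_system :=
  {| spread_alg := coprod (fun _ : nat => A);
     spread_fun := odot_inf hU1 (fun _ : nat => phi) j;
     spread_emb := fun i => cinj (fun _ : nat => A) i |}.

Section SpreadIndependence.
Variable S : spread_system.

Definition spread_moment n (i : 'I_n -> nat) (X : 'I_n -> A) : K :=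
  spread_fun S (nuprod [seq spread_emb S (i k) (X k) | k <- enum 'I_n]).

(* phi_pi(X_1, ..., X_n), with the indices i_k := position of the block of pi
   containing k, whose ordered kernel is pi (kappa_block_index); for S_odot any
   other indices with kernel pi give the same value (S_odot_spreadable). *)
Definition spread_osp n (pi : osp n) (X : 'I_n -> A) : K :=
  spread_moment (block_index pi) X.

Definition spread_independent (I : set nat) (B : I -> subalgebra A) : Prop :=
  forall n (i : 'I_n -> I) (X : 'I_n -> A) (pi : osp n), (0 < n)%N ->
    (forall k, subalg_set (B (i k)) (X k)) ->
    spread_osp pi X = spread_osp (quasi_meet pi (kappa (fun k => val (i k)))) X.

End SpreadIndependence.

Lemma S_odot_emb (hU1 : U1 P) j i x :
  spread_fun (S_odot hU1 j) (spread_emb (S_odot hU1 j) i x) = phi j x.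
Proof.
have E : cinj (fun _ : nat => A) i x =
    coprod_incl (fun _ : nat => A) i (cinj (fun _ : 'I_i.+1 => A) ord_max x).
  by rewrite /coprod_incl copair_inj.
by rewrite [LHS]/= E odot_infE odot_fin_inj.
Qed.

Lemma S_odot_spreadable (hU1 : U1 P) j n (i i' : 'I_n -> nat) (X : 'I_n -> A) :
  U6 P -> (0 < n)%N -> kappa i = kappa i' ->
  spread_moment (S_odot hU1 j) i X = spread_moment (S_odot hU1 j) i' X.
Proof.
case=> u hu n0 ii'; pose p := (\max_k i k + \max_k i' k)%N.
have key (h : 'I_n -> nat) : (forall k, h k <= p)%N ->
    spread_moment (S_odot hU1 j) h X =
    \sum_(sigma : {set {set 'I_n}} |
            partition sigma [set: 'I_n] && refines sigma (osp_underlying (kappa h)))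
    \sum_(f : {ffun {S : {set 'I_n} | S \in sigma} -> 'I_d})
      u j n sigma f (kappa h) *
      \prod_(S : {S : {set 'I_n} | S \in sigma})
        phi (f S) (nuprod [seq X l | l <- enum (val S)]).
  move=> hp; pose A' := fun _ : 'I_p.+1 => A.
  pose Y k : {i : 'I_p.+1 & A' i} := existT _ (inord (h k)) (X k).
  have EW : nuprod [seq cinj (fun _ : nat => A) (h k) (X k) | k <- enum 'I_n] =
      coprod_incl (fun _ : nat => A) p (word Y).
    rewrite /word nuprod_hom; congr nuprod; rewrite -[RHS]map_comp; apply: eq_map => k.
    rewrite [in RHS]/= /coprod_incl copair_inj.
    by have -> : nat_of_ord (inord (h k) : 'I_p.+1) = h k by rewrite inordK ?ltnS.
  have Ek : (fun k => nat_of_ord (tag (Y k))) = h.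
    by apply/funext => k; rewrite /= inordK ?ltnS.
  rewrite -[LHS]/(odot_inf hU1 (fun _ : nat => phi) j
    (nuprod [seq cinj (fun _ : nat => A) (h k) (X k) | k <- enum 'I_n])).
  rewrite EW odot_infE (hu p A' (fun _ => phi) n Y j n0) Ek.
  apply: eq_bigr => sigma /andP[sigmaP ref]; apply: eq_bigr => f _; congr (_ * _).
  apply: eq_bigr => -[S Ssig] _ /=; rewrite /block_value.
  case: pickP => [k kS|S0]; last first.
    case/and3P: sigmaP => _ _ /negP[]; rewrite (_ : finset.set0 = S) //.
    by apply/setP => k; rewrite inE S0.
  congr (phi _ _); congr nuprod; apply/eq_in_map => l; rewrite mem_enum => lS.
  have hkl := kappa_const ref Ssig kS lS.
  by apply: tagged_as_const; rewrite /= hkl.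
rewrite !key ?ii' // => k.
  by apply: leq_trans (leq_addl _ _); apply: leq_bigmax.
by apply: leq_trans (leq_addr _ _); apply: leq_bigmax.
Qed.

End Independence.

(* Main.v *)
Require Import Defs.
From mathcomp Require Import boolp classical_sets reals.
From mathcomp Require Import all_boot all_order all_algebra.
From mathcomp Require Import complex.

(** The point of the theorem is that a word whose letters carry two labels, a
    copy [b k] of [A] and a subalgebra [r k], can be evaluated in two ways.

    Work with the powers [odot_power phi p], the product of [p + 1] copies of
    [(A, phi)], on the constant coproduct [copower A p].  Let [C] be the
    coproduct of the subalgebras [B_0, ..., B_q].  It maps to [A] through the
    inclusions, and to [copower A q] by sending [B_m] into the [m]-th copy of
    [A] ([to_copies]).  By naturality of the product
    ([odot_fin_natural]), independence of the [B_m] says exactly that [phi] on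
    [A] and [odot_power phi q] on [copower A q] have the same pull-back to [C]
    ([odot_independent_finE]).

    If the family is independent, take the [p]-th power of this equality of
    functionals on [C].  On one side the moment of the word with copy
    labels [b] appears, i.e. the moment for the ordered partition [pi] with
    block indices [b]; on the other side a power of a power of [(A, phi)].
    Associativity (U2) flattens the latter into one power, the pair of labels
    [(b k, r k)] becoming its rank [b k * (q + 1) + r k] in lexicographic order
    ([odot_power_flatten]).  The ordered kernel of these ranks is the
    quasi-meet of the kernels of [b] and [r] ([quasi_meet_kappa]), and moments
    depend only on the ordered kernel of the labels, by (U6).  This is
    spreadability-system independence.

    Conversely, apply the latter to the partition with one block: the left-hand
    side is the moment in [A] by (U1), and the right-hand side is the moment in
    the power with labels [r].  As the coproduct is spanned by words
    ([coprod_word_ind]), the two functionals on [C] agree. *)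

Set Implicit Arguments.
Unset Strict Implicit.
Unset Printing Implicit Defensive.
Import GRing.Theory.
Local Open Scope ring_scope.

(** * Ordered kernels *)

Section Kernel.
Variable n : nat.

Definition level (h : 'I_n -> nat) (v : nat) : {set 'I_n} := [set k | h k == v].

Lemma level_neq0 (h : 'I_n -> nat) v : (level h v != finset.set0) = (v \in codom h).
Proof.
apply/set0Pn/codomP => [[k]|[k ->]]; last by exists k; rewrite inE.
by rewrite inE => /eqP <-; exists k.
Qed.

Lemma codom_sorted (h : 'I_n -> nat) : sorted ltn (sort leq (undup (codom h))).
Proof.
by rewrite ltn_sorted_uniq_leq sort_uniq undup_uniq sort_sorted //; exact: leq_total.
Qed.

(** The kernel can be read off any increasing list of candidate values: values
    that are not attained contribute empty level sets, which are dropped.  This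
    is the form in which quasi-meets are computed. *)
Lemma kappa_seq_sorted (h : 'I_n -> nat) (s : seq nat) :
  sorted ltn s -> {subset codom h <= s} ->
  kappa_seq h = [seq R <- [seq level h v | v <- s] | R != finset.set0].
Proof.
move=> ss hs; rewrite filter_map /kappa_seq; congr map.
apply: (irr_sorted_eq ltn_trans ltnn).
- exact: codom_sorted.
- exact: sorted_filter ltn_trans _ _ ss.
- move=> v; rewrite mem_sort mem_undup mem_filter /= level_neq0.
  by case: (boolP (v \in codom h)) => // /hs ->.
Qed.

Lemma kappa_comp_incr m (r : 'I_n -> 'I_m) (g : 'I_m -> nat) :
  {homo g : a b / (a < b)%N} -> kappa (fun k => g (r k)) = kappa (fun k => r k : nat).
Proof.
move=> gI; apply/val_inj => /=.
have ginj a b : (g a == g b) = (a == b).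
  apply/eqP/eqP => [E|-> //]; apply/val_inj/eqP.
  case: (ltngtP a b) => //= /gI; first by rewrite E ltnn.
  by rewrite E ltnn.
rewrite (@kappa_seq_sorted _ [seq g a | a <- enum 'I_m]).
- rewrite (@kappa_seq_sorted _ [seq val a | a <- enum 'I_m]).
  + rewrite -!map_comp; congr filter; apply: eq_map => a /=.
    by apply/setP => k; rewrite !inE ginj.
  + by rewrite val_enum_ord; exact: iota_ltn_sorted.
  + by move=> _ /codomP[k ->]; apply: map_f; rewrite mem_enum.
- have := iota_ltn_sorted 0 m; rewrite -val_enum_ord !sorted_map.
  by apply: sub_sorted => a b /gI.
- by move=> _ /codomP[k ->]; apply: map_f; rewrite mem_enum.
Qed.

(** Second coordinates below [m] are digits in base [m], so numerical order is
    lexicographic order. *)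
Lemma sorted_lex m (s t : seq nat) : sorted ltn s -> sorted ltn t ->
  all (gtn m) t -> sorted ltn [seq (v * m + w)%N | v <- s, w <- t].
Proof.
move=> ss st /allP tm; move: ss st; rewrite !(sorted_pairwise ltn_trans).
elim: s => //= v s IH /andP[/allP vs ss] st.
rewrite pairwise_cat IH // andbT; apply/andP; split.
  apply/allrelP => _ _ /mapP[w tw ->] /allpairsP[[v' w'] [/= sv' tw' ->]].
  apply: (@leq_trans (v.+1 * m)); first by rewrite mulSn addnC ltn_add2r; exact: tm.
  by apply: leq_trans (leq_addr _ _); rewrite leq_mul2r vs ?orbT.
by rewrite pairwise_map; apply: sub_pairwise st => w w' /=; rewrite ltn_add2l.
Qed.

(** The blocks of a quasi-meet are the intersections of level sets in
    lexicographic order of the pairs of values, and [v * q + w] is the rank of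
    the pair [(v, w)] in that order. *)
Lemma quasi_meet_kappa (b : 'I_n -> nat) q (r : 'I_n -> 'I_q) :
  quasi_meet (kappa b) (kappa (fun k => r k : nat)) = kappa (fun k => b k * q + r k)%N.
Proof.
apply/val_inj => /=; pose c k := (b k * q + r k)%N; rewrite -/c.
set vs := sort leq (undup (codom b)).
set ws := sort leq (undup (codom (fun k => r k : nat))).
have wq : all (gtn q) ws.
  by apply/allP => w; rewrite mem_sort mem_undup => /codomP[k ->] /=.
rewrite (@kappa_seq_sorted c [seq (v * q + w)%N | v <- vs, w <- ws]).
- rewrite /quasi_meet_seq /kappa_seq -/vs -/ws allpairs_mapl map_allpairs.
  under eq_map do rewrite -map_comp.
  congr filter; apply/eq_in_allpairs => v w _ /(allP wq) /= wltq.
  apply/setP => k; rewrite !inE /c; apply/andP/eqP => [[/eqP-> /eqP->] //|E].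
  have q0 : (0 < q)%N by apply: leq_ltn_trans wltq.
  have := congr1 (divn^~ q) E; have := congr1 (modn^~ q) E.
  rewrite /= !modnMDl !divnMDl // !modn_small ?divn_small // !addn0.
  by move=> -> ->; rewrite !eqxx.
- by apply: sorted_lex => //; exact: codom_sorted.
- move=> _ /codomP[k ->]; apply/allpairsP; exists (b k, r k : nat).
  by split => //=; rewrite mem_sort mem_undup; apply: codom_f.
Qed.

End Kernel.

(** * Words span the coproduct *)

Section NuAlgebraTheory.
Variables (K : fieldType) (B : nuAlgType K).

Lemma nmul0r (y : B) : nmul y 0 = 0.
Proof. by rewrite -(scale0r (0 : B)) -nscaleAr !scale0r. Qed.

Lemma nmul_suml (T : Type) (u : seq T) (F : T -> B) (y : B) :
  nmul (\sum_(e <- u) F e) y = \sum_(e <- u) nmul (F e) y.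
Proof. by elim: u => [|e u IH]; rewrite ?big_nil ?nmul0l // !big_cons nmulDl IH. Qed.

Lemma nmul_sumr (T : Type) (u : seq T) (F : T -> B) (y : B) :
  nmul y (\sum_(e <- u) F e) = \sum_(e <- u) nmul y (F e).
Proof. by elim: u => [|e u IH]; rewrite ?big_nil ?nmul0r // !big_cons nmulDr IH. Qed.

Lemma nuprod_cat (s t : seq B) : (0 < size s)%N -> (0 < size t)%N ->
  nuprod (s ++ t) = nmul (nuprod s) (nuprod t).
Proof.
case: s t => [|x s] [|y t] // _ _; rewrite [LHS]/= foldl_cat /=.
by elim/last_ind: t => //= t z; rewrite !foldl_rcons nmulA => ->.
Qed.

End NuAlgebraTheory.

Section WordSpan.
Variables (K : fieldType) (I : eqType) (A : I -> nuAlgType K).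

Let Span (x : coprod A) := exists2 s : seq (K * seq {i : I & A i}),
  all (fun e => 0 < size e.2)%N s &
  x = \sum_(e <- s) e.1 *: nuprod [seq cinj A (tag v) (tagged v) | v <- e.2].

(** Linear combinations of nonempty words contain the generators and are closed
    under products, since products of words are words. *)
Lemma coprod_word_ind (Q : coprod A -> Prop) :
  Q 0 -> (forall x y, Q x -> Q y -> Q (x + y)) -> (forall c x, Q x -> Q (c *: x)) ->
  (forall n (X : 'I_n -> {i : I & A i}), (0 < n)%N -> Q (word X)) -> forall x, Q x.
Proof.
move=> Q0 QD QZ QW x.
have : Span x.
  move: x; apply: coprod_ind.
  - move=> i a; exists [:: (1, [:: existT _ i a])] => //.
    by rewrite big_seq1 scale1r.
  - by exists [::]; rewrite ?big_nil.
  - move=> _ _ [s hs ->] [t ht ->]; exists (s ++ t); first by rewrite all_cat hs.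
    by rewrite big_cat.
  - move=> c _ [s hs ->]; exists [seq (c * e.1, e.2) | e <- s]; first by rewrite all_map.
    by rewrite big_map scaler_sumr; apply: eq_bigr => e _; rewrite scalerA.
  - move=> _ _ [s hs ->] [t ht ->].
    exists [seq (e.1 * f.1, e.2 ++ f.2) | e <- s, f <- t].
      apply/allP => _ /allpairsP[[e f] [/= /(allP hs) he _ ->]] /=.
      by rewrite size_cat addn_gt0 he.
    rewrite big_allpairs_dep /=.
    rewrite nmul_suml big_seq [RHS]big_seq; apply: eq_bigr => e /(allP hs) he.
    rewrite nmul_sumr big_seq [RHS]big_seq; apply: eq_bigr => f /(allP ht) hf.
    by rewrite map_cat nuprod_cat ?size_map // -nscaleAl -nscaleAr scalerA.
case=> s + ->; elim: s => [_|[c w] s IH /= /andP[hw /IH Qs]]; first by rewrite big_nil.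
rewrite big_cons; apply: (QD) => //; apply: QZ => /=.
suff <- : word (fun k : 'I_(size w) => tnth (in_tuple w) k) =
   nuprod [seq cinj A (tag v) (tagged v) | v <- w] by exact: QW.
rewrite /word; congr nuprod.
by rewrite -[X in _ = map _ X](map_tnth_enum (in_tuple w)) -map_comp.
Qed.

End WordSpan.

(** * Naturality and associativity of finite products *)

Section CoprodMap.
Variables (K : fieldType) (I : Type) (D A : I -> nuAlgType K).
Variable f : forall i, nuhom (D i) (A i).

Definition coprod_map : nuhom (coprod D) (coprod A) :=
  copair (fun i => nuhom_comp (cinj A i) (f i)).

Lemma coprod_map_inj i x : coprod_map (cinj D i x) = cinj A i (f i x).
Proof. exact: copair_inj. Qed.

End CoprodMap.

Section Products.
Variables (K : fieldType) (d : nat) (P : universal_product K d).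

Lemma coprod_split0 p (A : 'I_p.+2 -> nuAlgType K) a :
  coprod_split A (cinj A ord0 a) = cinl _ _ a.
Proof. by rewrite /coprod_split copair_inj ordS_case0. Qed.

Lemma coprod_splitS p (A : 'I_p.+2 -> nuAlgType K) i a :
  coprod_split A (cinj A (lift ord0 i) a) =
  cinr _ _ (cinj (fun i : 'I_p.+1 => A (lift ord0 i)) i a).
Proof. by rewrite /coprod_split copair_inj ordS_caseS nuhom_compE. Qed.

Lemma coprod_collapse0 (A : 'I_1 -> nuAlgType K) a :
  coprod_collapse A (cinj A ord0 a) = a.
Proof. by rewrite /coprod_collapse copair_inj ordS_case0. Qed.

Lemma coprod2_mapl (A1 A2 B1 B2 : nuAlgType K) (f : nuhom A1 B1) (g : nuhom A2 B2) a :
  coprod2_map f g (cinl A1 A2 a) = cinl B1 B2 (f a).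
Proof. by rewrite /coprod2_map copair2_inl. Qed.

Lemma coprod2_mapr (A1 A2 B1 B2 : nuAlgType K) (f : nuhom A1 B1) (g : nuhom A2 B2) a :
  coprod2_map f g (cinr A1 A2 a) = cinr B1 B2 (g a).
Proof. by rewrite /coprod2_map copair2_inr. Qed.

Lemma coprod2_assoc1 (A1 A2 A3 : nuAlgType K) a :
  coprod2_assoc A1 A2 A3 (cinl _ _ (cinl _ _ a)) = cinl _ _ a.
Proof. by rewrite /coprod2_assoc copair2_inl copair2_inl. Qed.

Lemma coprod2_assoc2 (A1 A2 A3 : nuAlgType K) a :
  coprod2_assoc A1 A2 A3 (cinl _ _ (cinr _ _ a)) = cinr _ _ (cinl _ _ a).
Proof. by rewrite /coprod2_assoc copair2_inl copair2_inr. Qed.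

Lemma coprod2_assoc3 (A1 A2 A3 : nuAlgType K) a :
  coprod2_assoc A1 A2 A3 (cinr _ _ a) = cinr _ _ (cinr _ _ a).
Proof. by rewrite /coprod2_assoc copair2_inr. Qed.

Lemma algP_arrow_id (A : nuAlgType K) (phi : 'I_d -> {scalar A}) :
  algP_arrow phi phi (nuhom_id A).
Proof. by []. Qed.

(** Functoriality of the binary product, iterated. *)
Lemma odot_fin_natural p (D A : 'I_p.+1 -> nuAlgType K)
    (psi : forall i, 'I_d -> {scalar D i}) (phi : forall i, 'I_d -> {scalar A i})
    (f : forall i, nuhom (D i) (A i)) :
  (forall i, algP_arrow (psi i) (phi i) (f i)) ->
  algP_arrow (odot_fin P psi) (odot_fin P phi) (coprod_map f).
Proof.
elim: p D A psi phi f => [|p IH] D A psi phi f hf j x.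
  have E : coprod_collapse A (coprod_map f x) = f ord0 (coprod_collapse D x).
    apply: (coprod_ext (g := nuhom_comp (coprod_collapse A) (coprod_map f))
      (h := nuhom_comp (f ord0) (coprod_collapse D))); apply: ordS_case => [a|[]//].
    by rewrite !nuhom_compE coprod_map_inj !coprod_collapse0.
  by rewrite [LHS]/= E hf.
have E : coprod_split A (coprod_map f x) =
    coprod2_map (f ord0) (coprod_map (fun i => f (lift ord0 i))) (coprod_split D x).
  apply: (coprod_ext (g := nuhom_comp (coprod_split A) (coprod_map f))
    (h := nuhom_comp (coprod2_map (f ord0) (coprod_map (fun i => f (lift ord0 i))))
       (coprod_split D))); apply: ordS_case => [a|i a].
    by rewrite !nuhom_compE coprod_map_inj !coprod_split0 coprod2_mapl.
  by rewrite !nuhom_compE coprod_map_inj !coprod_splitS coprod2_mapr coprod_map_inj.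
rewrite [LHS]/= E; apply: odot_natural (hf ord0) _ j (coprod_split D x).
by apply: IH => i; exact: hf.
Qed.

Section Power.
Hypothesis hU2 : U2 P.

Definition copower (A : nuAlgType K) p : nuAlgType K := coprod (fun _ : 'I_p.+1 => A).
Definition odot_power (A : nuAlgType K) (phi : 'I_d -> {scalar A}) p :
  'I_d -> {scalar copower A p} := odot_fin P (fun _ : 'I_p.+1 => phi).

(** Factors are numbered by naturals, so that renumberings are plain arithmetic;
    numbers above [p] stand for the factor [0]. *)
Definition copower_inj (A : nuAlgType K) p (v : nat) : nuhom A (copower A p) :=
  cinj (fun _ : 'I_p.+1 => A) (inord v).

Lemma copower_ext (A B : nuAlgType K) p (g h : nuhom (copower A p) B) :
  (forall v a, (v <= p)%N -> g (copower_inj A p v a) = h (copower_inj A p v a)) -> g =1 h.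
Proof.
move=> gh; apply: coprod_ext => i a; rewrite -(inord_val i).
by apply: gh; rewrite -ltnS.
Qed.

Lemma inord0 p : inord 0 = ord0 :> 'I_p.+1.
Proof. by apply/val_inj; rewrite /= inordK. Qed.

Lemma lift0_inord p v : (v <= p)%N -> lift ord0 (inord v : 'I_p.+1) = inord v.+1.
Proof. by move=> vp; apply/val_inj; rewrite /= /bump leq0n add1n !inordK. Qed.

Definition copower_split (A : nuAlgType K) p :
    nuhom (copower A p.+1) (coprod2 A (copower A p)) :=
  coprod_split (fun _ : 'I_p.+2 => A).

Lemma copower_split0 (A : nuAlgType K) p a :
  copower_split A p (copower_inj A p.+1 0 a) = cinl _ _ a.
Proof. by rewrite /copower_split /copower_inj inord0 coprod_split0. Qed.

Lemma copower_splitS (A : nuAlgType K) p v a : (v <= p)%N ->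
  copower_split A p (copower_inj A p.+1 v.+1 a) = cinr _ _ (copower_inj A p v a).
Proof. by move=> vp; rewrite /copower_split /copower_inj -lift0_inord // coprod_splitS. Qed.

Definition copower_map (A B : nuAlgType K) p (f : nuhom A B) :
    nuhom (copower A p) (copower B p) :=
  coprod_map (fun _ : 'I_p.+1 => f).

Lemma copower_map_in (A B : nuAlgType K) p (f : nuhom A B) v a :
  copower_map p f (copower_inj A p v a) = copower_inj B p v (f a).
Proof. exact: coprod_map_inj. Qed.

Definition copower_lift (A B : nuAlgType K) p (f : nat -> nuhom A B) :
  nuhom (copower A p) B := copair (fun i : 'I_p.+1 => f i).

Lemma copower_lift_in (A B : nuAlgType K) p (f : nat -> nuhom A B) v a :
  (v <= p)%N -> copower_lift p f (copower_inj A p v a) = f v a.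
Proof. by move=> vp; rewrite /copower_lift /copower_inj copair_inj inordK. Qed.

Definition copower_concat (A : nuAlgType K) p q :
    nuhom (coprod2 (copower A p) (copower A q)) (copower A (p + q).+1) :=
  copair2 (copower_lift p (copower_inj A (p + q).+1))
    (copower_lift q (fun v => copower_inj A (p + q).+1 (p.+1 + v))).

Lemma copower_concatl (A : nuAlgType K) p q v a : (v <= p)%N ->
  copower_concat A p q (cinl _ _ (copower_inj A p v a)) = copower_inj A (p + q).+1 v a.
Proof. by move=> vp; rewrite /copower_concat copair2_inl copower_lift_in. Qed.

Lemma copower_concatr (A : nuAlgType K) p q v a : (v <= q)%N ->
  copower_concat A p q (cinr _ _ (copower_inj A q v a)) =
  copower_inj A (p + q).+1 (p.+1 + v) a.
Proof. by move=> vq; rewrite /copower_concat copair2_inr copower_lift_in. Qed.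

Lemma copower2_ext (A B : nuAlgType K) p q
    (g h : nuhom (coprod2 (copower A p) (copower A q)) B) :
  (forall v a, (v <= p)%N ->
     g (cinl _ _ (copower_inj A p v a)) = h (cinl _ _ (copower_inj A p v a))) ->
  (forall v a, (v <= q)%N ->
     g (cinr _ _ (copower_inj A q v a)) = h (cinr _ _ (copower_inj A q v a))) ->
  g =1 h.
Proof.
move=> H1 H2; apply: coprod2_ext => x.
  exact: (copower_ext (g := nuhom_comp g (cinl _ _)) (h := nuhom_comp h (cinl _ _))).
exact: (copower_ext (g := nuhom_comp g (cinr _ _)) (h := nuhom_comp h (cinr _ _))).
Qed.

(** A product of [p + 1] copies times a product of [q + 1] copies is the product
    of [p + q + 2] copies.  Powers are bracketed to the right, so peeling off the
    first copy and applying (U2) reduces to [p - 1]. *)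
Lemma odot_power_concat (A : nuAlgType K) (phi : 'I_d -> {scalar A}) p q :
  algP_arrow (odot P (odot_power phi p) (odot_power phi q)) (odot_power phi (p + q).+1)
    (copower_concat A p q).
Proof.
elim: p => [|p IH] j y.
  rewrite -[LHS]/(odot P phi (odot_power phi q) j
    (copower_split A q (copower_concat A 0 q y))).
  have -> : copower_split A q (copower_concat A 0 q y) =
      coprod2_map (coprod_collapse (fun _ : 'I_1 => A)) (nuhom_id _) y.
    apply: (copower2_ext (g := nuhom_comp (copower_split A q)
      (copower_concat A 0 q))) => v a.
      rewrite leqn0 => /eqP ->; rewrite nuhom_compE copower_concatl // copower_split0.
      by rewrite coprod2_mapl /copower_inj inord0 coprod_collapse0.
    by move=> vq; rewrite nuhom_compE copower_concatr // copower_splitS // coprod2_mapr.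
  by apply: odot_natural.
rewrite -[LHS]/(odot P phi (odot_power phi (p + q).+1) j
  (copower_split A (p + q).+1 (copower_concat A p.+1 q y))).
have -> : copower_split A (p + q).+1 (copower_concat A p.+1 q y) =
    coprod2_map (nuhom_id A) (copower_concat A p q)
      (coprod2_assoc _ _ _ (coprod2_map (copower_split A p) (nuhom_id _) y)).
  apply: (copower2_ext
    (g := nuhom_comp (copower_split A (p + q).+1) (copower_concat A p.+1 q))
    (h := nuhom_comp (coprod2_map (nuhom_id A) (copower_concat A p q)) (nuhom_comp
      (coprod2_assoc _ _ _) (coprod2_map (copower_split A p) (nuhom_id _)))))
    => [[|v]|v] a vp;
    rewrite !nuhom_compE.
  - by rewrite copower_concatl // copower_split0 coprod2_mapl copower_split0 coprod2_assoc1
      coprod2_mapl.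
  - have vpq : (v <= p + q)%N by apply: leq_trans (leq_addr _ _).
    rewrite copower_concatl // coprod2_mapl [in RHS]copower_splitS // coprod2_assoc2.
    by rewrite coprod2_mapr copower_concatl // copower_splitS // ltnW.
  - have vpq : (p.+1 + v <= (p + q).+1)%N by rewrite addSn ltnS leq_add2l.
    rewrite copower_concatr // coprod2_mapr coprod2_assoc3 coprod2_mapr copower_concatr //.
    exact: copower_splitS.
rewrite (odot_natural P (algP_arrow_id phi) IH).
by rewrite hU2; apply: odot_natural.
Qed.

(** The largest of the lexicographic ranks [v * (q + 1) + w] with [v <= p] and
    [w <= q]; the number of factors is this plus one, [(p + 1) * (q + 1)]. *)
Definition lex_size p q := (p * q.+1 + q)%N.

Definition copower_flatten (A : nuAlgType K) p q :
    nuhom (copower (copower A q) p) (copower A (lex_size p q)) :=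
  copower_lift p (fun v => copower_lift q (fun w =>
    copower_inj A (lex_size p q) (v * q.+1 + w))).

Lemma copower_flatten_in (A : nuAlgType K) p q v w a : (v <= p)%N -> (w <= q)%N ->
  copower_flatten A p q (copower_inj _ p v (copower_inj A q w a)) =
  copower_inj A (lex_size p q) (v * q.+1 + w) a.
Proof. by move=> vp wq; rewrite /copower_flatten !copower_lift_in. Qed.

Lemma copower_copower_ext (A B : nuAlgType K) p q
    (g h : nuhom (copower (copower A q) p) B) :
  (forall v w a, (v <= p)%N -> (w <= q)%N ->
     g (copower_inj _ p v (copower_inj A q w a)) =
     h (copower_inj _ p v (copower_inj A q w a))) -> g =1 h.
Proof.
move=> gh; apply: copower_ext => v x vp; move: x.
apply: (copower_ext (g := nuhom_comp g (copower_inj _ p v))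
  (h := nuhom_comp h (copower_inj _ p v))).
by move=> w a wq; exact: gh.
Qed.

(** A power of a power is a power, the factors being ranked lexicographically:
    peeling off one block of copies at a time reduces to [odot_power_concat]. *)
Lemma odot_power_flatten (A : nuAlgType K) (phi : 'I_d -> {scalar A}) p q :
  algP_arrow (odot_power (odot_power phi q) p) (odot_power phi (lex_size p q))
    (copower_flatten A p q).
Proof.
elim: p => [|p IH] j x.
  rewrite -[RHS]/(odot_power phi q j (coprod_collapse (fun _ : 'I_1 => copower A q) x)).
  congr (odot_power phi q j _).
  apply: copower_copower_ext => v w a; rewrite leqn0 => /eqP -> wq.
  rewrite copower_flatten_in //.
  by rewrite /copower_inj inord0 coprod_collapse0.
rewrite -[RHS]/(odot P (odot_power phi q) (odot_power (odot_power phi q) p) j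
  (copower_split (copower A q) p x)).
rewrite -(odot_natural P (algP_arrow_id (odot_power phi q)) IH).
rewrite -odot_power_concat.
have E : lex_size p.+1 q = (q + lex_size p q).+1 by rewrite /lex_size mulSn !addSn addnA.
rewrite /copower_flatten E; congr (odot_power phi _ j _).
apply: (copower_copower_ext (h := nuhom_comp (copower_concat A q (lex_size p q)) (nuhom_comp
  (coprod2_map (nuhom_id _) (copower_flatten A p q)) (copower_split (copower A q) p))))
  => -[|v] w a vp wq;
  rewrite !copower_lift_in // !nuhom_compE.
  by rewrite copower_split0 coprod2_mapl nuhom_idE copower_concatl // mul0n.
rewrite copower_splitS // coprod2_mapr copower_flatten_in // copower_concatr
  ?mulSn ?addnA //.
by apply: leq_add => //; rewrite leq_mul2r -ltnS vp orbT.
Qed.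

End Power.
End Products.

(** * Independence and moments *)

Section Spread.
Variables (K : fieldType) (d : nat) (P : universal_product K d).
Variables (hU1 : U1 P) (A : nuAlgType K) (phi : 'I_d -> {scalar A}).

(** A moment involves finitely many copies only, so the infinite product may be
    replaced with any power that contains the labels in use. *)
Lemma spread_moment_odot_power n (h : 'I_n -> nat) (X : 'I_n -> A) p j :
  (forall k, h k <= p)%N -> spread_moment (S_odot phi hU1 j) h X =
  odot_power P phi p j (nuprod [seq copower_inj A p (h k) (X k) | k <- enum 'I_n]).
Proof.
move=> hp; rewrite -[RHS](odot_infE hU1 (fun _ : nat => phi)) nuprod_hom -map_comp.
congr (odot_inf _ _ _ (nuprod _)); apply: eq_map => k.
by rewrite /= /coprod_incl /copower_inj copair_inj inordK // ltnS.
Qed.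

Section Words.
Variables (I : set nat) (B : I -> subalgebra A) (q : nat) (t : 'I_q.+1 -> I).
Let C m : nuAlgType K := subalg_type (B (t m)).

Definition to_copies : nuhom (coprod C) (copower A q) :=
  coprod_map (fun m => subalg_incl (B (t m))).

Lemma to_copies_inj m (a : C m) : to_copies (cinj C m a) = copower_inj A q m (val a).
Proof. by rewrite /to_copies coprod_map_inj /copower_inj inord_val. Qed.

(** By naturality along the inclusions of the subalgebras, independence can be
    stated with copies of the whole algebra.  This replaces a family of factors
    of varying type with a constant one. *)
Lemma odot_independent_finE : odot_independent_fin P phi (fun m => B (t m)) <->
  forall j x, phi j (copair (fun m => subalg_incl (B (t m))) x) =
    odot_power P phi q j (to_copies x).
Proof.
have E j x : odot_power P phi q j (to_copies x) =
    odot_fin P (fun i r => scalar_comp (phi r) (subalg_incl (B (t i)))) j x.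
  exact: (odot_fin_natural P (D := C) (phi := fun=> phi)
    (f := fun m => subalg_incl (B (t m)))).
by split=> h j x; have := h j x; rewrite E.
Qed.

End Words.

(** Independence is about increasing finite subfamilies, whereas a moment has
    letters in arbitrary order with repetitions; the indices that occur in it
    are therefore listed increasingly as [t], and [r] gives their positions. *)
Lemma incr_cover (I : set nat) n (i : 'I_n.+1 -> I) : exists q (t : 'I_q.+1 -> I)
    (r : 'I_n.+1 -> 'I_q.+1),
  {homo t : k l / (k < l)%N >-> (val k < val l)%N} /\ i =1 t \o r.
Proof.
pose s := sort (fun a b : I => (val a <= val b)%N) (undup (codom i)).
have si k : i k \in s by rewrite mem_sort mem_undup codom_f.
have s0 : (size s).-1.+1 = size s by rewrite prednK //; case: s si => // /(_ ord0).
have ss : sorted (fun a b : I => (val a < val b)%N) s.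
  have : sorted ltn (map val s).
    rewrite ltn_sorted_uniq_leq (map_inj_uniq val_inj) sort_uniq undup_uniq sorted_map.
    by apply: sort_sorted => a b; exact: leq_total.
  by rewrite sorted_map.
exists (size s).-1, (fun m => nth (i ord0) s m), (fun k => inord (index (i k) s)).
split=> [a b ab|k].
  apply: (sorted_ltn_nth (leT := fun a b : I => (val a < val b)%N)) => //.
  - by move=> x y z; exact: ltn_trans.
  - exact: leq_trans (ltn_ord a) (eq_leq s0).
  - exact: leq_trans (ltn_ord b) (eq_leq s0).
by rewrite /= inordK ?nth_index // s0 index_mem.
Qed.

Hypothesis hU6 : U6 P.

(** Powers of equal functionals on the coproduct of the subalgebras are equal;
    flattening turns the labels into lexicographic ranks. *)
Lemma odot_spread_independent (hU2 : U2 P) (I : set nat) (B : I -> subalgebra A) :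
  odot_independent P phi B -> forall j, spread_independent (S_odot phi hU1 j) B.
Proof.
move=> hind j [|n] // i X pi _ hX.
have [q [t [r [ht it]]]] := incr_cover i.
have /odot_independent_finE hq := hind q t ht.
have hX' k : X k \in subalg_pred (B (t (r k))).
  by apply/asboolP; have := hX k; rewrite it.
pose C m : nuAlgType K := subalg_type (B (t m)).
pose x k : coprod C := cinj C (r k) (SubalgElt (hX' k)).
pose b := block_index pi; pose p := size pi.
have bp k : (b k <= p)%N by exact: ltnW (block_index_lt pi k).
have rq k : (r k <= q)%N by rewrite -ltnS.
pose psi j := scalar_comp (phi j) (copair (fun m => subalg_incl (B (t m)))).
pose w := nuprod [seq copower_inj (coprod C) p (b k) (x k) | k <- enum 'I_n.+1].
(* Both powers are pulled back to the power of C, where they are equal. *)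
have -> : spread_osp (S_odot phi hU1 j) pi X = odot_power P psi p j w.
  rewrite /spread_osp (spread_moment_odot_power _ _ bp).
  rewrite -(odot_fin_natural P (psi := fun=> psi) (phi := fun=> phi)
    (f := fun=> copair (fun m => subalg_incl (B (t m))))) //.
  rewrite nuprod_hom; congr (odot_power _ _ _ _ (nuprod _)); rewrite -[RHS]map_comp.
  by apply: eq_map => k /=; rewrite copower_map_in /x copair_inj.
have -> : odot_power P psi p j w =
    odot_power P (odot_power P phi q) p j (copower_map p (to_copies B t) w).
  by symmetry; apply: odot_fin_natural => _ j' y; rewrite -hq.
rewrite -odot_power_flatten // 2!nuprod_hom /spread_osp.
pose c k := (b k * q.+1 + r k)%N.
rewrite (S_odot_spreadable phi hU1 j (i' := c) X hU6) //.
  have cp k : (c k <= lex_size p q)%N.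
    by rewrite /c /lex_size leq_add // leq_mul2r bp orbT.
  rewrite (spread_moment_odot_power _ _ cp).
  congr (odot_power _ _ _ _ (nuprod _)).
  rewrite -[in LHS]map_comp -[LHS]map_comp; apply: eq_map => k.
  rewrite -[LHS]/(copower_flatten A p q
    (copower_map p (to_copies B t) (copower_inj _ p (b k) (x k)))).
  by rewrite copower_map_in to_copies_inj copower_flatten_in.
rewrite kappa_block_index -quasi_meet_kappa kappa_block_index.
rewrite -(kappa_comp_incr (g := fun m => val (t m)) r ht).
by congr (quasi_meet _ (kappa _)); apply/funext => k; rewrite it.
Qed.

Lemma spread_odot_independent (I : set nat) (B : I -> subalgebra A) :
  (forall j, spread_independent (S_odot phi hU1 j) B) -> odot_independent P phi B.
Proof.
move=> hS q t ht; apply/odot_independent_finE => j x.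
move: x; apply: coprod_word_ind => [|x y hx hy|c x hx|n Y n0].
- by rewrite !linear0.
- by rewrite !linearD hx hy.
- by rewrite !linearZ hx.
pose X k := val (tagged (Y k)); pose r k := tag (Y k).
have hX k : subalg_set (B (t (r k))) (X k) by apply/asboolP; exact: subalg_valP.
(* The partition with one block is the kernel of a constant labelling. *)
have := hS j n (fun k => t (r k)) X (kappa (fun=> 0%N)) n0 hX.
rewrite /spread_osp (S_odot_spreadable phi hU1 j (i' := fun=> 0%N) X hU6 n0);
  last by rewrite kappa_block_index.
rewrite [RHS](S_odot_spreadable phi hU1 j (i' := fun k => r k : nat) X hU6 n0); last first.
  (* The rank of (0, r k) is r k, by computation of 0 * (q + 1) + r k. *)
  rewrite kappa_block_index (kappa_comp_incr (g := fun m => val (t m)) r ht).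
  by rewrite quasi_meet_kappa.
rewrite /word !nuprod_hom => E.
transitivity (spread_moment (S_odot phi hU1 j) (fun=> 0%N) X).
  rewrite -(S_odot_emb phi hU1 j 0) nuprod_hom /spread_moment.
  congr (spread_fun _ (nuprod _)); rewrite -[in LHS]map_comp -[LHS]map_comp.
  by apply: eq_map => k; rewrite /= copair_inj.
have rq k : (r k <= q)%N by rewrite -ltnS.
rewrite E (spread_moment_odot_power _ _ rq).
congr (odot_power _ _ _ _ (nuprod _)); rewrite -[RHS]map_comp; apply: eq_map => k.
rewrite -[RHS]/(to_copies B t (cinj (fun m => subalg_type (B (t m))) _ _)).
by rewrite to_copies_inj.
Qed.

End Spread.

Theorem proposition2p18 (R : realType) (d : nat) (hd : (0 < d)%N)
    (P : universal_product R[i] d) (hU1 : U1 P) (hU2 : U2 P) (hU6 : U6 P)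
    (A : nuAlgType R[i]) (phi : 'I_d -> {scalar A})
    (I : set nat) (B : I -> subalgebra A) :
  odot_independent P phi B <->
  (forall j : 'I_d, spread_independent (S_odot phi hU1 j) B).
Proof.
split; first exact: odot_spread_independent.
exact: spread_odot_independent.
Qed.
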